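(* Let $\mathcal T$ be a set of tile designs, with $t_{\mathrm{id}}$ tiles, for the pentagonal icositetrahedron with symmetry group the rotational octahedral group $O$ (order $24$). Then the number of ways of tiling the faces of the pentagonal icositetrahedron up to rotational octahedral symmetry $O$ is $$\frac{1}{24}\left(t_{\mathrm{id}}^{24}+6t_{\mathrm{id}}^{6}+3t_{\mathrm{id}}^{12}+8t_{\mathrm{id}}^{8}+6t_{\mathrm{id}}^{12}\right)=\frac{1}{24}\left(t_{\mathrm{id}}^{24}+9t_{\mathrm{id}}^{12}+8t_{\mathrm{id}}^{8}+6t_{\mathrm{id}}^{6}\right).$$
   Context: Tilings. Let $P$ be a polyhedron with set of faces $\mathcal F$ and let $\mathcal A$ be a group of isometries of $P$, acting on $\mathcal F$. A set of tile designs is a finite set $\mathcal T$ together with a group action of $\mathcal A$ on $\mathcal T\times\mathcal F$ lying over the action on $\mathcal F$ (so $A\cdot(T,F)=(T',A\cdot F)$ for some $T'\in\mathcal T$); write $t_{\mathrm{id}}=|\mathcal T|$. A tiling is a map $\tau:\mathcal F\to\mathcal T$; $\mathcal A$ acts on tilings by moving graphs: $A\cdot\tau$ is the tiling with $((A\cdot\tau)(A\cdot F),A\cdot F)=A\cdot(\tau(F),F)$ for all $F$. The number of ways of tiling up to $\mathcal A$ is the number of $\mathcal A$-orbits on the set of tilings. Polyhedron and group. Here $\mathcal A=O$ is the group of order $24$ of all $3\times3$ signed permutation matrices of determinant $1$. The pentagonal icositetrahedron (the Catalan solid dual to the snub cube) is the convex hull of the $O$-orbits of $(\alpha,0,0)$,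 $(1,1,1)$ and $(1,\beta,\gamma)$, where $\alpha\approx1.83929$ is the real root of $x^3-x^2-x-1$, $\beta=\alpha^2-2$ and $\gamma=\alpha^{-2}$ ($6+8+24=38$ vertices, $24$ non-regular pentagonal faces); its isometry group is $O$. The group of symmetries of a face induced by its stabilizer in $O$ is trivial. *)

(* Defs.v *)
(* The points of Euclidean 3-space are the column vectors ['cV[R]_3], with
   [R : realType] the field of real numbers. *)
From mathcomp Require Import all_boot all_order all_algebra all_fingroup.
From mathcomp Require Import finmap.
From mathcomp Require Import boolp classical_sets functions cardinality.
From mathcomp Require Import reals convex.

Set Implicit Arguments.
Unset Strict Implicit.
Unset Printing Implicit Defensive.

Import Order.TTheory GRing.Theory Num.Theory.

Local Open Scope classical_set_scope.
Local Open Scope ring_scope.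

Definition convex_hull (R : realType) (V : set 'cV[R]_3) : set 'cV[R]_3 :=
  smallest (@convex_set R 'cV[R]_3) V.

Definition mximage (R : realType) (M : 'M[R]_3) (S : set 'cV[R]_3) :
  set 'cV[R]_3 := [set M *m x | x in S].

Lemma mximage_convex_hull (R : realType) (M : 'M[R]_3) (V : set 'cV[R]_3) :
  mximage M V `<=` V -> mximage M (convex_hull V) `<=` convex_hull V.
Proof.
move=> MV _ [x Vx <-] C [Cc VC].
pose C' := [set y | C (M *m y)].
suff : C' x by [].
apply: Vx; split; last by move=> y Vy; apply/VC/MV; exists y.
move=> y z t; rewrite !inE => Cy Cz.
have := Cc _ _ t (mem_set Cy) (mem_set Cz).
by rewrite inE /C' /= /conv /= mulmxDr -!scalemxAr.
Qed.

(* The two-dimensional faces of [P]: the intersections of [P] with a supporting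
   plane that contain three affinely independent points. *)
Definition is_face (R : realType) (P F : set 'cV[R]_3) : Prop :=
  (exists (c : 'rV[R]_3) (b : R),
     [/\ c != 0,
         (forall x, P x -> (c *m x) 0 0 <= b) &
         F = [set x | P x /\ (c *m x) 0 0 = b]]) /\
  (exists x y z, [/\ F x, F y, F z & \rank (row_mx (y - x) (z - x)) = 2%N]).

Definition face (R : realType) (P : set 'cV[R]_3) := {F | is_face P F}.

(* A group of (linear) isometries of [P]. *)
Record isometry_group (R : realType) (P : set 'cV[R]_3) := IsometryGroup {
  isometries : set 'M[R]_3;
  isometries_orthogonal : forall M, isometries M -> M^T *m M = 1%:M;
  isometries_stable : forall M, isometries M -> mximage M P = P;
  isometries1 : isometries 1%:M;
  isometriesM : forall M N, isometries M -> isometries N -> isometries (M *m N);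
  isometriesV : forall M, isometries M -> isometries (invmx M)
}.

Definition elt (R : realType) (P : set 'cV[R]_3) (A : isometry_group P) :=
  {M : 'M[R]_3 | isometries A M}.

Section Action.
Variables (R : realType) (P : set 'cV[R]_3) (A : isometry_group P).

Definition elt1 : elt A := exist _ 1%:M (isometries1 A).

Definition eltM (g h : elt A) : elt A :=
  exist _ (sval g *m sval h) (isometriesM (svalP g) (svalP h)).

Definition eltV (g : elt A) : elt A :=
  exist _ (invmx (sval g)) (isometriesV (svalP g)).

Lemma mximage_face (g : elt A) (F : face P) :
  is_face P (mximage (sval g) (sval F)).
Proof.
case: g F => M AM [F [[c [b [c0 cb Fdef]]] [x [y [z [Fx Fy Fz rk]]]]]] /=.
have MtM := isometries_orthogonal AM.
have cM v : c *m M^T *m (M *m v) = c *m v.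
  by rewrite mulmxA -(mulmxA c) MtM mulmx1.
split.
- exists (c *m M^T), b; split.
  + apply: contra_neq c0 => cMt0.
    by rewrite -[c]mulmx1 -MtM mulmxA cMt0 mul0mx.
  + move=> v; rewrite -{1}(isometries_stable AM) => -[w Pw <-].
    by rewrite cM; apply: cb.
  + rewrite Fdef; apply/seteqP; split=> [_ [w [Pw cw] <-]|v []] /=.
      by rewrite cM; split=> //; rewrite -(isometries_stable AM); exists w.
    by rewrite -{1}(isometries_stable AM) => -[w Pw <-]; rewrite cM; exists w.
- exists (M *m x), (M *m y), (M *m z).
  split; [by exists x|by exists y|by exists z|].
  rewrite -!mulmxBr -mul_mx_row -mxrank_tr trmx_mul mxrankMfree ?mxrank_tr //.
  by rewrite row_free_unit unitmx_tr; case: (mulmx1_unit MtM).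
Qed.

Definition face_act (g : elt A) (F : face P) : face P :=
  exist _ (mximage (sval g) (sval F)) (mximage_face g F).

(* A finite set of tiles with an action of [A] on [tile * face P] lying over
   the action on the faces. *)
Record tile_designs := TileDesigns {
  tile : finType;
  tile_act : elt A -> tile * face P -> tile * face P;
  tile_act1 : forall u, tile_act elt1 u = u;
  tile_actM : forall g h u, tile_act (eltM g h) u = tile_act g (tile_act h u);
  tile_act_face : forall g u, (tile_act g u).2 = face_act g u.2
}.

Lemma face_inj (F G : face P) : sval F = sval G -> F = G.
Proof. by case: F G => F hF [G hG] /= FG; exact: eq_exist. Qed.

Lemma face_actM g h F : face_act (eltM g h) F = face_act g (face_act h F).
Proof.
apply: face_inj => /=; apply/seteqP; split=> [_ [x Fx <-]|_ [_ [x Fx <-] <-]].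
  by exists (sval h *m x); [exists x|rewrite mulmxA].
by exists x; rewrite ?mulmxA.
Qed.

Lemma face_act1 F : face_act elt1 F = F.
Proof.
apply: face_inj => /=; apply/seteqP; split=> [_ [x Fx <-]|x Fx].
  by rewrite mul1mx.
by exists x; rewrite ?mul1mx.
Qed.

Lemma elt_unitmx (g : elt A) : sval g \in unitmx.
Proof. by case: (mulmx1_unit (isometries_orthogonal (svalP g))). Qed.

Lemma eltMV g : eltM g (eltV g) = elt1.
Proof. by apply: eq_exist; rewrite /= mulmxV ?elt_unitmx. Qed.

Lemma eltVM g : eltM (eltV g) g = elt1.
Proof. by apply: eq_exist; rewrite /= mulVmx ?elt_unitmx. Qed.

Variable D : tile_designs.

Definition tiling := face P -> tile D.

(* [A] moves graphs, so the tile of [g . tau] on [F] comes from the tile of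
   [tau] on the face that [g] carries to [F]. *)
Definition tiling_act (g : elt A) (tau : tiling) : tiling := fun F =>
  let G := face_act (eltV g) F in (tile_act g (tau G, G)).1.

Lemma tiling_actE g tau F :
  (tiling_act g tau (face_act g F), face_act g F) = tile_act g (tau F, F).
Proof.
rewrite /tiling_act /= -face_actM eltVM face_act1.
by rewrite [RHS]surjective_pairing tile_act_face.
Qed.

Definition tiling_orbit (tau : tiling) : set tiling :=
  range (fun g => tiling_act g tau).

Definition tiling_orbits : set (set tiling) := range tiling_orbit.

End Action.

Arguments tiling_orbits {R P A} D.

Section PentagonalIcositetrahedron.
Variables (R : realType).

Definition signed_perm_mx (d : 'rV[R]_3) (s : 'S_3) : 'M[R]_3 :=
  diag_mx d *m perm_mx s.

Definition octahedral_rotations : set 'M[R]_3 :=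
  [set M | (exists (d : 'rV[R]_3) (s : 'S_3),
              (forall i, d 0 i = 1 \/ d 0 i = -1) /\
              M = signed_perm_mx d s) /\
           \det M = 1].

Definition point3 (x y z : R) : 'cV[R]_3 := \col_i [:: x; y; z]`_i.

Definition octahedral_orbit (v : 'cV[R]_3) : set 'cV[R]_3 :=
  [set M *m v | M in octahedral_rotations].

(* [alpha] is meant to be the real root of ['X^3 - 'X^2 - 'X - 1]. *)
Definition pentagonal_icositetrahedron (alpha : R) : set 'cV[R]_3 :=
  convex_hull
    (octahedral_orbit (point3 alpha 0 0) `|`
     octahedral_orbit (point3 1 1 1) `|`
     octahedral_orbit (point3 1 (alpha ^+ 2 - 2) (alpha ^- 2))).

Lemma octahedral_orthogonal M : octahedral_rotations M -> M^T *m M = 1%:M.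
Proof.
move=> [[d [s [d1 ->]]] _]; rewrite /signed_perm_mx trmx_mul tr_diag_mx.
rewrite -mulmxA (mulmxA (diag_mx d)) mulmx_diag.
have -> : \row_j (d 0 j * d 0 j) = const_mx 1.
  by apply/rowP => j; rewrite !mxE; case: (d1 j) => ->; rewrite ?mulrNN mulr1.
by rewrite diag_const_mx mul1mx tr_perm_mx -perm_mxM mulVg perm_mx1.
Qed.

Lemma octahedral1 : octahedral_rotations 1%:M.
Proof.
split; last exact: det1.
exists (const_mx 1), 1%g; split; first by move=> i; rewrite mxE; left.
by rewrite /signed_perm_mx perm_mx1 mulmx1 diag_const_mx.
Qed.

Lemma octahedralM M N : octahedral_rotations M -> octahedral_rotations N ->
  octahedral_rotations (M *m N).
Proof.
move=> [[d [s [d1 ->]]] dM] [[e [t [e1 ->]]] dN].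
split; last by rewrite det_mulmx dM dN mulr1.
exists (\row_i (d 0 i * e 0 (s i))), (s * t)%g; split=> [i|].
  rewrite mxE; case: (d1 i) => ->; case: (e1 (s i)) => ->.
  - by left; rewrite mulr1.
  - by right; rewrite mul1r.
  - by right; rewrite mulr1.
  - by left; rewrite mulrNN mulr1.
rewrite /signed_perm_mx perm_mxM !mulmxA; congr (_ *m _).
apply/matrixP => i j; rewrite mul_mx_diag mxE !mul_diag_mx !mxE.
have [<-|_] := eqVneq (s i) j; first by rewrite !mulr1.
by rewrite !mulr0 mul0r.
Qed.

Lemma octahedralV M : octahedral_rotations M -> octahedral_rotations (invmx M).
Proof.
move=> OM; have MtM := octahedral_orthogonal OM.
have [_ uM] := mulmx1_unit MtM.
have -> : invmx M = M^T by rewrite -[LHS]mul1mx -MtM mulmxK.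
case: OM => -[d [s [d1 ->]]] dM; split; last by rewrite det_tr.
exists (\row_i d 0 ((s^-1)%g i)), (s^-1)%g; split=> [i|].
  by rewrite mxE; apply: d1.
rewrite /signed_perm_mx trmx_mul tr_diag_mx tr_perm_mx.
apply/matrixP => i j; rewrite mul_mx_diag mul_diag_mx !mxE.
have [<-|_] := eqVneq ((s^-1)%g i) j; first by rewrite mul1r mulr1.
by rewrite mul0r mulr0.
Qed.

Lemma octahedral_stable (alpha : R) M : octahedral_rotations M ->
  mximage M (pentagonal_icositetrahedron alpha) =
  pentagonal_icositetrahedron alpha.
Proof.
move=> OM.
have sub N : octahedral_rotations N ->
    mximage N (pentagonal_icositetrahedron alpha) `<=`
    pentagonal_icositetrahedron alpha.
  move=> ON; apply: mximage_convex_hull.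
  move=> _ [x Vx <-]; case: Vx => [[]|] [K OK <-]; [left; left|left; right|right];
    by exists (N *m K); rewrite ?mulmxA //; apply: octahedralM.
apply/seteqP; split; first exact: sub.
move=> x Px; exists (invmx M *m x).
  by apply: (sub _ (octahedralV OM)); exists x.
by rewrite mulKVmx //; case: (mulmx1_unit (octahedral_orthogonal OM)).
Qed.

Definition octahedral_group (alpha : R) :
    isometry_group (pentagonal_icositetrahedron alpha) :=
  IsometryGroup octahedral_orthogonal (@octahedral_stable alpha)
    octahedral1 octahedralM octahedralV.

End PentagonalIcositetrahedron.

(* Main.v *)
Require Import Defs.
From mathcomp Require Import all_boot all_order all_algebra all_fingroup cyclic.
From mathcomp Require Import finmap.
From mathcomp Require Import boolp classical_sets functions cardinality reals.
From mathcomp Require Import interval_inference convex.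
From mathcomp Require Import ring lra.
From HB Require Import structures.
Import Order.TTheory GRing.Theory Num.Theory.
Local Open Scope ring_scope.

Set Implicit Arguments.
Unset Strict Implicit.
Unset Printing Implicit Defensive.

(** The rotation group acts simply transitively on the faces of the pentagonal
    icositetrahedron.  After the choice of a base face, faces become elements
    of the group, and transporting every tile back to the base face turns
    tilings into maps from the group to the set of tiles, on which the group
    acts by translation ([coloring_act]): how the designs are permuted when a
    tile moves no longer matters, because no rotation but the identity fixes a
    face.  A map is fixed by the translation by [g] when it is constant on the
    right cosets of [<[g]>], so there are [t ^ (24 / #[g])] such maps
    ([card_translate_fix]), and the orbit counting lemma gives the number of
    orbits as an average of these powers over the group
    ([card_translation_orbits], [tiling_orbits_card]).  The group has 1, 9, 8
    and 6 elements of orders 1, 2, 3 and 4 ([sum_rotation_order]), which yields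
    the formula.

    The substance is thus in the simple transitivity ([rotation_regular]).  The
    base face lies in the plane [n . x = alpha^2], where
    [n = (alpha, 1, 1/alpha)]; its vertices are [(alpha,0,0)],
    [(beta,1,-gamma)], [(1,beta,gamma)], [(1,1,1)] and [(beta,gamma,1)].  The
    inequality [n . x <= alpha^2] on the polyhedron is a finite check on the
    orbits of vertices ([normal0_le]), and so is the triviality of the
    stabilizer ([face0_free]).

    That there are no further faces follows from the fact that the cones over
    the rotated copies of the base face cover the space.  Given [q], rotate it
    so that [n . q] is the largest possible; comparing with the normals of the
    five neighbouring faces shows that [q] is then inside the five planes that
    join the origin to the edges of the base face, hence in the cone over this
    face ([face0_cone]).  Consequently ([gauge]) there are a rotation [h] and
    [r >= 0] with [n . h q = r alpha^2], such that [c . q <= r b] for every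
    inequality [c . x <= b] valid on the polyhedron.  Let now a face be cut out
    by [c . x <= b], and let [x], [y], [z] be affinely independent points of
    it.  For [q = x + y + z] the second property gives [r >= 3], while
    [n . h x], [n . h y] and [n . h z] are at most [alpha^2]; so all three are
    equal to [alpha^2], the planes [c . v = b] and [n . h v = alpha^2]
    coincide, and the face is the image of the base face by the inverse of [h]
    ([face_rotated]). *)

(** * Colorings of a finite group up to translation *)

Section Coloring.
Variables (gT : finGroupType) (T : finType).
Local Open Scope group_scope.

Definition translate (f : {ffun gT -> T}) (g : gT) : {ffun gT -> T} :=
  [ffun x => f (g * x)].

Lemma translate1 : translate^~ 1 =1 id.
Proof. by move=> f; apply/ffunP => x; rewrite ffunE mul1g. Qed.

Lemma translateM f g h : translate f (g * h) = translate (translate f g) h.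
Proof. by apply/ffunP => x; rewrite !ffunE mulgA. Qed.

Definition translation := TotalAction translate1 translateM.

Lemma translate_fixP g (f : {ffun gT -> T}) :
  reflect (forall x, f (g * x) = f x) (f \in 'Fix_translation[g]).
Proof.
apply: (iffP afix1P) => [fg x|fg]; first by rewrite -[in RHS]fg ffunE.
by apply/ffunP => x; rewrite ffunE.
Qed.

(** The colorings fixed by [g] are the pullbacks of the colorings of the set of
    right cosets of [<[g]>]. *)
Lemma card_translate_fix g :
  #|'Fix_translation[g]| = (#|T| ^ (#|gT| %/ #[g]))%N.
Proof.
pose I := {C : {set gT} | C \in rcosets <[g]> [set: gT]}.
have cosP x : <[g]> :* x \in rcosets <[g]> [set: gT].
  by apply/rcosetsP; exists x.
pose cl x : I :=
  exist (fun C => is_true (C \in rcosets <[g]> [set: gT])) _ (cosP x).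
have cl_surj (C : I) : cl (repr (val C)) = C.
  apply: val_inj => /=; case: C => C /= /rcosetsP[x _ ->].
  exact/rcoset_eqP/mem_repr_rcoset.
pose lift_coloring (h : {ffun I -> T}) : {ffun gT -> T} := [ffun x => h (cl x)].
have lift_inj : injective lift_coloring.
  move=> h k /ffunP hk; apply/ffunP => C.
  by have := hk (repr (val C)); rewrite !ffunE cl_surj.
have -> : 'Fix_translation[g] = [set lift_coloring h | h in predT].
  apply/setP => f; apply/translate_fixP/imsetP => [fg|[h _ ->] x]; last first.
    rewrite !ffunE; congr (h _); apply: val_inj; apply/rcoset_eqP => /=.
    by rewrite mem_rcoset mulgK cycle_id.
  exists [ffun C : I => f (repr (val C))] => //; apply/ffunP => x.
  rewrite !ffunE /=.
  have /rcosetP[_ /cycleP[i ->] ->] := mem_repr_rcoset <[g]> x.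
  by elim: i => [|i IH]; rewrite ?mul1g // expgS -mulgA fg.
rewrite card_imset // cardT -cardE card_ffun; congr (_ ^ _)%N.
rewrite card_sig -[LHS]/(#|[set: gT] : <[g]>|) -divgS;
  last exact: finset.subsetT.
by rewrite /= cardsT.
Qed.

Lemma card_translation_orbits :
  (#|orbit translation [set: gT] @: [set: {ffun gT -> T}]| * #|gT|)%N =
  (\sum_(g : gT) #|T| ^ (#|gT| %/ #[g]))%N.
Proof.
rewrite -[X in (_ * X)%N]cardsT -Frobenius_Cauchy; last first.
  by apply/actsP => g _ f; rewrite !inE.
rewrite big_mkcond /=; apply: eq_bigr => g _.
by rewrite inE finset.setTI card_translate_fix.
Qed.

End Coloring.

(** * Tilings when the group is regular on the faces *)

Lemma elt_inj (R : realType) (P : set 'cV[R]_3) (A : isometry_group P)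
  (a b : elt A) : sval a = sval b -> a = b.
Proof. by case: a b => M hM [N hN] /= MN; exact: eq_exist. Qed.

Section RegularFaceAction.
Variables (R : realType) (P : set 'cV[R]_3) (A : isometry_group P).
Variables (D : tile_designs A) (gT : finGroupType) (e : gT -> elt A).
Hypothesis eM : forall g h, e (g * h)%g = eltM (e g) (e h).
Hypothesis e_surj : forall a, exists g, e g = a.
Variable F0 : face P.
Hypothesis regular : bijective (fun g => face_act (e g) F0).

Lemma elt_of1 : e 1%g = elt1 A.
Proof.
have [h h1] := e_surj (elt1 A).
by rewrite -h1 -[in RHS](mulg1 h) eM h1; apply: elt_inj; rewrite /= mul1mx.
Qed.

Lemma tile_actVK g u : tile_act (t := D) (e g^-1%g) (tile_act (e g) u) = u.
Proof. by rewrite -tile_actM -eM mulVg elt_of1 tile_act1. Qed.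

Lemma tile_actKV g u : tile_act (t := D) (e g) (tile_act (e g^-1%g) u) = u.
Proof. by rewrite -tile_actM -eM mulgV elt_of1 tile_act1. Qed.

Let face_of g := face_act (e g) F0.

Let face_ofM g h : face_of (g * h)%g = face_act (e g) (face_of h).
Proof. by rewrite /face_of eM face_actM. Qed.

Let face_of1 : face_of 1%g = F0.
Proof. by rewrite /face_of elt_of1 face_act1. Qed.

(** The color of [g] is the tile on the face [g F0], brought back to [F0]. *)
Definition coloring (tau : tiling D) : {ffun gT -> tile D} :=
  [ffun g => (tile_act (e g^-1%g) (tau (face_of g), face_of g)).1].

Lemma coloringE tau g :
  tile_act (e g) (coloring tau g, F0) = (tau (face_of g), face_of g).
Proof.
rewrite ffunE -[X in (_, X)](_ :
  (tile_act (e g^-1%g) (tau (face_of g), face_of g)).2 = F0).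
  by rewrite -surjective_pairing tile_actKV.
by rewrite tile_act_face -face_ofM mulVg face_of1.
Qed.

Lemma coloring_bij : bijective coloring.
Proof.
have [ix face_ofK ixK] := regular.
exists (fun (s : {ffun gT -> tile D}) F =>
    (tile_act (e (ix F)) (s (ix F), F0)).1).
  move=> tau; apply/funext => F.
  by rewrite coloringE /=; congr (tau _); exact: ixK.
move=> s; apply/ffunP => g; rewrite ffunE (face_ofK g : ix (face_of g) = g).
rewrite -[X in (_, X)](_ : (tile_act (e g) (s g, F0)).2 = face_of g).
  by rewrite -surjective_pairing tile_actVK.
by rewrite tile_act_face.
Qed.

Lemma coloring_act g tau :
  coloring (tiling_act (e g) tau) = translate (coloring tau) g^-1%g.
Proof.
apply/ffunP => x; rewrite !ffunE; congr (_.1).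
rewrite invMg invgK eM tile_actM.
have -> : face_of x = face_act (e g) (face_of (g^-1 * x)%g).
  by rewrite -face_ofM mulKVg.
by rewrite tiling_actE.
Qed.

Lemma tiling_orbits_card :
  finite_set (tiling_orbits D) /\
  (#|` fset_set (tiling_orbits D)| * #|gT|)%N =
  (\sum_(g : gT) #|tile D| ^ (#|gT| %/ #[g]%g))%N.
Proof.
have [tau_of tau_ofK colorK] := coloring_bij.
pose orbs := orbit (translation gT (tile D)) [set: gT]
  @: [set: {ffun gT -> tile D}].
pose pull (O : {set {ffun gT -> tile D}}) : set (tiling D) :=
  [set tau | coloring tau \in O]%classic.
have pull_inj : injective pull.
  move=> O O' /seteqP[sub sup]; apply/setP => s.
  by rewrite -[s]colorK; apply/idP/idP => [/sub|/sup].
have pull_orbit tau : tiling_orbit tau =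
    pull (orbit (translation gT (tile D)) [set: gT] (coloring tau)).
  apply/seteqP; split=> [_ [a _ <-]|tau'] /=.
    have [g <-] := e_surj a; rewrite /pull /= coloring_act.
    by apply/orbitP; exists g^-1%g; rewrite ?inE.
  move/orbitP => [g _ /= tauE]; exists (e g^-1%g) => //.
  by apply: (can_inj tau_ofK); rewrite /= coloring_act invgK.
have orbsE : tiling_orbits D = (pull @` [set` orbs])%classic.
  apply/seteqP; split=> [_ [tau _ <-]|_ [_ /imsetP[s _ ->] <-]].
    exists (orbit (translation _ _) [set: gT] (coloring tau)).
      by rewrite /= /orbs; apply: imset_f; rewrite inE.
    by rewrite pull_orbit.
  by exists (tau_of s) => //; rewrite pull_orbit colorK.
have fin_orbs : finite_set [set` orbs]%classic by [].
split; first by rewrite orbsE; apply: finite_image.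
rewrite orbsE fset_set_image // card_imfset //= -card_translation_orbits.
congr (_ * _)%N.
rewrite [X in fset_set X](_ : _ = [set` [fset O in enum orbs]%fset]%classic).
  by rewrite set_fsetK card_fseq undup_id ?enum_uniq // -cardE.
by apply/seteqP; split=> O; rewrite /= !inE mem_enum.
Qed.

End RegularFaceAction.

(** * The rotation group of the cube, in a computable form *)

(** A signed permutation matrix is encoded by its rows: the entry [(s, j)] at
    rank [i] says that the only nonzero coefficient of row [i] is in column [j]
    and that it is -1 if [s] is true, 1 otherwise.  On these codes the group
    laws and the orders of the elements are obtained by evaluation. *)
Definition signed_perm := seq (bool * nat).

Definition spnth (c : signed_perm) i := nth (false, 0%N) c i.

Definition sp_entry (R : pzRingType) (c : signed_perm) (i j : nat) : R :=
  if j == (spnth c i).2 then (if (spnth c i).1 then -1 else 1) else 0.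

Definition sp_mx (R : pzRingType) (c : signed_perm) : 'M[R]_3 :=
  \matrix_(i, j) sp_entry R c i j.

Definition det3 (R : pzRingType) (m : nat -> nat -> R) : R :=
    m 0%N 0%N * (m 1%N 1%N * m 2%N 2%N - m 1%N 2%N * m 2%N 1%N)
  - m 0%N 1%N * (m 1%N 0%N * m 2%N 2%N - m 1%N 2%N * m 2%N 0%N)
  + m 0%N 2%N * (m 1%N 0%N * m 2%N 1%N - m 1%N 1%N * m 2%N 0%N).

Lemma det_mx33 (R : comPzRingType) (m : nat -> nat -> R) :
  \det (\matrix_(i < 3, j < 3) m i j) = det3 m.
Proof.
rewrite (expand_det_row _ ord0) !big_ord_recl big_ord0 addr0 /cofactor.
rewrite !(expand_det_row _ ord0) !big_ord_recl !big_ord0 /cofactor !det_mx11.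
rewrite !mxE /= /det3 /bump /=; ring.
Qed.

Lemma det_sp_mx (R : comPzRingType) (c : signed_perm) :
  \det (sp_mx R c) = (det3 (sp_entry int c))%:~R.
Proof.
rewrite -det_mx33 -(det_map_mx (@intmul R 1)); congr (\det _).
apply/matrixP => i j; rewrite !mxE /sp_entry.
by case: eqP => // _; case: (_.1); rewrite ?rmorphN ?rmorph1.
Qed.

(** The condition on the determinant also discards the codes in which a column
    occurs twice. *)
Definition rotation_codes : seq signed_perm :=
  let row := [seq (s, j) | s <- [:: false; true], j <- iota 0 3] in
  [seq c <- [seq p :: c | p <- row, c <- [seq [:: q; r] | q <- row, r <- row]]
     | det3 (sp_entry int c) == 1].

Lemma rotation_codesE : rotation_codes =
  ltac:(let l := eval vm_compute in rotation_codes in exact l).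
Proof. by vm_compute. Qed.

Definition sp_one : signed_perm := [seq (false, i) | i <- iota 0 3].

Definition sp_mul (c d : signed_perm) : signed_perm :=
  [seq (p.1 (+) (spnth d p.2).1, (spnth d p.2).2) | p <- c].

Definition sp_inv (c : signed_perm) : signed_perm :=
  [seq let k := index i (unzip2 c) in ((spnth c k).1, k) | i <- iota 0 3].

Definition rotation := seq_sub rotation_codes.
HB.instance Definition _ := SubFinite.on rotation.

Lemma sp_one_rotation : sp_one \in rotation_codes.
Proof. by vm_compute. Qed.

Lemma sp_mul_rotation (g h : rotation) :
  sp_mul (val g) (val h) \in rotation_codes.
Proof.
have /allP/(_ _ (valP g))/allP/(_ _ (valP h)) // :
  all (fun c => all (fun d => sp_mul c d \in rotation_codes) rotation_codes)
    rotation_codes by vm_compute.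
Qed.

Lemma sp_inv_rotation (g : rotation) : sp_inv (val g) \in rotation_codes.
Proof.
by have /allP/(_ _ (valP g)) : all (fun c => sp_inv c \in rotation_codes)
  rotation_codes by vm_compute.
Qed.

Definition rotM (g h : rotation) : rotation := SeqSub (sp_mul_rotation g h).
Definition rotV (g : rotation) : rotation := SeqSub (sp_inv_rotation g).
Definition rot1 : rotation := SeqSub sp_one_rotation.

Lemma rotMA : associative rotM.
Proof.
have /allP assoc : all (fun c => all (fun d => all (fun e =>
    sp_mul c (sp_mul d e) == sp_mul (sp_mul c d) e)
  rotation_codes) rotation_codes) rotation_codes by vm_compute.
move=> g h k; apply: val_inj; apply/eqP.
by have /allP/(_ _ (valP h))/allP/(_ _ (valP k)) := assoc _ (valP g).
Qed.

Lemma rot1M : left_id rot1 rotM.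
Proof.
move=> g; apply: val_inj; apply/eqP.
by have /allP/(_ _ (valP g)) : all (fun c => sp_mul sp_one c == c)
  rotation_codes by vm_compute.
Qed.

Lemma rotVM : left_inverse rot1 rotV rotM.
Proof.
move=> g; apply: val_inj; apply/eqP.
by have /allP/(_ _ (valP g)) : all (fun c => sp_mul (sp_inv c) c == sp_one)
  rotation_codes by vm_compute.
Qed.

HB.instance Definition _ := Finite_isGroup.Build rotation rotMA rot1M rotVM.

Lemma card_rotation : #|{: rotation}| = 24%N.
Proof. by rewrite card_seq_sub; vm_compute. Qed.

(** The least positive exponent that kills [c]; the bound 24 suffices because
    it is the order of the group. *)
Definition sp_order (c : signed_perm) : nat :=
  (find (fun k => iter k.+1 (sp_mul c) sp_one == sp_one) (iota 0 24)).+1.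

Lemma order_rotation (g : rotation) : #[g]%g = sp_order (val g).
Proof.
rewrite /sp_order; set a := fun k : nat => _.
have powE n : val (g ^+ n)%g = iter n (sp_mul (val g)) sp_one.
  by elim: n => [|n IH] //; rewrite expgS iterS -IH.
have aE k : a k = (#[g]%g %| k.+1)%N.
  by rewrite order_dvdn /a -powE -[RHS](inj_eq val_inj).
have ord_gt0 := order_gt0 g.
have ord_le : (#[g]%g.-1 < 24)%N.
  rewrite prednK // -card_rotation -cardsT; apply: subset_leq_card.
  exact: finset.subsetT.
have a_ord : a #[g]%g.-1 by rewrite aE prednK.
have ahas : has a (iota 0 24).
  by apply/hasP; exists #[g]%g.-1; rewrite ?mem_iota.
have := nth_find 0%N ahas; rewrite nth_iota; last first.
  by rewrite -{2}(size_iota 0 24) -has_find.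
rewrite aE add0n => /dvdn_leq -/(_ isT) le1.
apply/eqP; rewrite eqn_leq le1 andTb -(prednK ord_gt0) ltnS leqNgt.
apply/negP => lt_find; have := before_find 0%N lt_find.
by rewrite nth_iota // add0n a_ord.
Qed.

Lemma sum_rotation_order (F : nat -> nat) :
  (\sum_(g : rotation) F #[g]%g = F 1 + 9 * F 2 + 8 * F 3 + 6 * F 4)%N.
Proof.
have -> : (\sum_(g : rotation) F #[g]%g =
    \sum_(n <- [seq sp_order c | c <- rotation_codes]) F n)%N.
  rewrite big_map (eq_bigr _ (fun g _ => congr1 F (order_rotation g))).
  rewrite -(big_map val xpredT (fun c => F (sp_order c))).
  apply/perm_big/uniq_perm; last 1 first.
    move=> c; apply/mapP/idP => [[g _ ->]|Rc]; first exact: valP.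
    by exists (SeqSub Rc); rewrite ?mem_index_enum.
  by rewrite map_inj_uniq ?index_enum_uniq //; apply: val_inj.
by vm_compute.
have -> : [seq sp_order c | c <- rotation_codes] = ltac:(
    let l := eval vm_compute in [seq sp_order c | c <- rotation_codes] in
    exact l) by vm_compute.
by rewrite !big_cons big_nil; ring.
Qed.

(** * Rotations as matrices *)

Section Representation.
Variable R : realType.

Definition rot_mx (g : rotation) : 'M[R]_3 := sp_mx R (val g).

Lemma size_rotation (g : rotation) : size (val g) = 3%N.
Proof.
by have /allP/(_ _ (valP g))/eqP : all (fun c => size c == 3%N) rotation_codes
  by vm_compute.
Qed.

Lemma rot_idx_lt (g : rotation) (i : 'I_3) : ((spnth (val g) i).2 < 3)%N.
Proof.
have /allP/(_ _ (valP g))/allP all3 :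
  all (fun c => all (fun p => (p.2 < 3)%N) c) rotation_codes by vm_compute.
by apply/all3/mem_nth; rewrite size_rotation.
Qed.

Definition rot_idx (g : rotation) (i : 'I_3) : 'I_3 :=
  Ordinal (rot_idx_lt g i).

Definition rot_sgn (g : rotation) (i : 'I_3) : R :=
  if (spnth (val g) i).1 then -1 else 1.

Lemma rot_mxE g i j :
  rot_mx g i j = if j == rot_idx g i then rot_sgn g i else 0.
Proof. by rewrite mxE. Qed.

Lemma rot_mulE n g (M : 'M[R]_(3, n)) i j :
  (rot_mx g *m M) i j = rot_sgn g i * M (rot_idx g i) j.
Proof.
rewrite mxE (bigD1 (rot_idx g i)) //= rot_mxE eqxx big1 ?addr0 //.
by move=> k /negPf k_g; rewrite rot_mxE k_g mul0r.
Qed.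

Lemma rot_mxM g h : rot_mx (g * h)%g = rot_mx g *m rot_mx h.
Proof.
apply/matrixP => i j; rewrite rot_mulE !rot_mxE.
have row : spnth (val (g * h)%g) i =
    ((spnth (val g) i).1 (+) (spnth (val h) (rot_idx g i)).1,
     (spnth (val h) (rot_idx g i)).2).
  by rewrite /spnth (nth_map (false, 0%N)) // size_rotation.
have -> : rot_idx (g * h)%g i = rot_idx h (rot_idx g i).
  by apply: val_inj; rewrite /= row.
rewrite /rot_sgn row /=; case: eqP => _; last by rewrite mulr0.
by case: (_.1) (_.1) => [] []; rewrite ?mulrNN ?mul1r ?mulr1.
Qed.

Lemma rot_mx1 : rot_mx 1%g = 1%:M.
Proof.
apply/matrixP => i j; rewrite rot_mxE mxE eq_sym /rot_idx /rot_sgn /=.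
by case: i j => -[|[|[|//]]] ? [[|[|[|//]]] ?].
Qed.

Lemma rot_mxV (g : rotation) : rot_mx g^-1%g *m rot_mx g = 1%:M.
Proof. by rewrite -rot_mxM mulVg rot_mx1. Qed.

Lemma rot_mx_octahedral g : octahedral_rotations (rot_mx g).
Proof.
split; last first.
  have /eqP det1 : det3 (sp_entry int (val g)) == 1.
    by have := valP g; rewrite mem_filter => /andP[].
  by rewrite det_sp_mx det1 rmorph1.
have idx_inj : injective (rot_idx g).
  have /allP/(_ _ (valP g)) : all (fun c => uniq [seq p.2 | p <- c])
    rotation_codes by vm_compute.
  move=> ug i j /(congr1 val) /= ij; apply: val_inj; apply/eqP.
  have lt_size (k : 'I_3) : (val k < size (val g))%N.
    by rewrite size_rotation ltn_ord.
  rewrite -(nth_uniq 0%N _ _ ug) ?size_map ?lt_size //.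
  by rewrite !(nth_map (false, 0%N)) ?lt_size //; apply/eqP.
exists (\row_i rot_sgn g i), (perm idx_inj); split.
  by move=> i; rewrite mxE /rot_sgn; case: (_.1); [right|left].
apply/matrixP => i j; rewrite rot_mxE /signed_perm_mx mul_diag_mx !mxE permE.
by rewrite eq_sym; case: eqP; rewrite ?mulr1 ?mulr0.
Qed.

Lemma octahedral_rot_mx M : octahedral_rotations M -> exists g, M = rot_mx g.
Proof.
case=> -[d [s [d1 ->]]] detM.
pose c : signed_perm := [seq (d 0 i == -1, val (s i)) | i <- enum 'I_3].
have cE (i : 'I_3) : spnth c i = (d 0 i == -1, val (s i)).
  by rewrite /spnth (nth_map ord0) ?size_enum_ord // nth_ord_enum.
have McE : signed_perm_mx d s = sp_mx R c.
  apply/matrixP => i j; rewrite /signed_perm_mx mul_diag_mx !mxE /sp_entry cE /=.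
  rewrite [j == _ :> nat]eq_sym; have [->|sj] := eqVneq (s i) j; last first.
    by rewrite -[_ == _ :> nat]/(s i == j) (negPf sj) mulr0.
  by rewrite eqxx mulr1; case: eqP => //; case: (d1 i).
have row_mem (i : 'I_3) : (d 0 i == -1, val (s i)) \in
    [seq (b, j) | b <- [:: false; true], j <- iota 0 3].
  by apply: allpairs_f; [case: (_ == _) | rewrite mem_iota /=].
suff Rc : c \in rotation_codes by exists (SeqSub Rc).
rewrite mem_filter; apply/andP; split; last first.
  have -> : c = (d 0 ord0 == -1, val (s ord0)) ::
      [:: (d 0 (lift ord0 ord0) == -1, val (s (lift ord0 ord0)));
          (d 0 (lift ord0 (lift ord0 ord0)) == -1,
             val (s (lift ord0 (lift ord0 ord0))))].
    by rewrite /c !enum_ordSl enum_ord0.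
  by apply: (allpairs_f cons) => //; apply: (allpairs_f (fun q r => [:: q; r])).
by rewrite -(inj_eq (@intr_inj R)) -det_sp_mx rmorph1 -detM McE.
Qed.

End Representation.

(** * Vectors in space *)

Section Vectors.
Variable R : realType.
Implicit Types (u v w p : 'cV[R]_3) (a b c x y z t : R).

Lemma point3P v : exists x y z, v = point3 x y z.
Proof.
exists (v ord0 0), (v (lift ord0 ord0) 0), (v (lift ord0 (lift ord0 ord0)) 0).
apply/colP => i; rewrite mxE.
by case: i => -[|[|[|//]]] i3 /=; congr (v _ _); apply: val_inj.
Qed.

Lemma point3D x y z a b c :
  point3 x y z + point3 a b c = point3 (x + a) (y + b) (z + c).
Proof. by apply/colP => -[[|[|[|//]]] ?]; rewrite !mxE. Qed.

Lemma point3Z t x y z : t *: point3 x y z = point3 (t * x) (t * y) (t * z).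
Proof. by apply/colP => -[[|[|[|//]]] ?]; rewrite !mxE. Qed.

Lemma point3_inj x y z a b c :
  point3 x y z = point3 a b c -> [/\ x = a, y = b & z = c].
Proof.
move/colP => E; have e i := E i; move: (e ord0) (e (lift ord0 ord0)).
by move: (e (lift ord0 (lift ord0 ord0))); rewrite !mxE /=.
Qed.

Lemma mx11D (M N : 'M[R]_1) : (M + N) 0 0 = M 0 0 + N 0 0.
Proof. by rewrite mxE. Qed.

Lemma mx11Z t (M : 'M[R]_1) : (t *: M) 0 0 = t * M 0 0.
Proof. by rewrite mxE. Qed.

Definition dot u v : R := (u^T *m v) 0 0.

Lemma dotE x y z a b c :
  dot (point3 x y z) (point3 a b c) = x * a + y * b + z * c.
Proof. by rewrite /dot mxE !big_ord_recl big_ord0 !mxE /= addr0 addrA. Qed.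

Lemma dotDr u v w : dot u (v + w) = dot u v + dot u w.
Proof. by rewrite /dot mulmxDr mxE. Qed.

Lemma dotZr u t v : dot u (t *: v) = t * dot u v.
Proof. by rewrite /dot -scalemxAr mxE. Qed.

Lemma sp_mx_point3 (s : signed_perm) x y z : s \in rotation_codes ->
  sp_mx R s *m point3 x y z =
  let r i :=
    (if (spnth s i).1 then -1 else 1) * nth 0 [:: x; y; z] (spnth s i).2 in
  point3 (r 0%N) (r 1%N) (r 2%N).
Proof.
move=> Rs; apply/colP => i; rewrite -/(rot_mx R (SeqSub Rs)) rot_mulE !mxE.
by case: i => -[|[|[|//]]] ?.
Qed.

(** The triple product: [0 <= vol u v p] says on which side of the plane
    spanned by [u] and [v] the point [p] lies. *)
Definition vol u v w : R := det3 (fun i j => [:: u; v; w]`_i (inord j) 0).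

Lemma volE a b c x y z a' b' c' :
  vol (point3 a b c) (point3 x y z) (point3 a' b' c') =
  a * (y * c' - z * b') - b * (x * c' - z * a') + c * (x * b' - y * a').
Proof. by rewrite /vol /det3 /= !mxE !inordK. Qed.

Lemma vol_swap u v p : vol v u p = - vol u v p.
Proof.
have [[? [? [? ->]]] [? [? [? ->]]]] := (point3P u, point3P v).
by have [? [? [? ->]]] := point3P p; rewrite !volE; ring.
Qed.

(** By Cramer's rule, a simplicial cone is the intersection of the half-spaces
    bounded by its three sides. *)
Lemma cone3 u v w p :
  0 < vol u v w -> 0 <= vol v w p -> 0 <= vol w u p -> 0 <= vol u v p ->
  exists a b c, [/\ 0 <= a, 0 <= b, 0 <= c & p = a *: u + b *: v + c *: w].
Proof.
move=> d0 pu pv pw.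
exists (vol v w p / vol u v w), (vol w u p / vol u v w), (vol u v p / vol u v w).
split; rewrite ?divr_ge0 ?(ltW d0) //; move: (lt0r_neq0 d0).
have [[ux [uy [uz ->]]] [vx [vy [vz ->]]]] := (point3P u, point3P v).
have [[wx [wy [wz ->]]] [px [py [pz ->]]]] := (point3P w, point3P p).
rewrite !volE !point3Z !point3D => d_neq0.
by congr point3; field.
Qed.

Lemma rank_free_pair u v :
  (forall a b, a *: u + b *: v = 0 -> a = 0 /\ b = 0) ->
  \rank (row_mx u v) = 2%N.
Proof.
move=> free; apply/eqP; rewrite -mxrank_tr -[_ == _]/(row_free _).
apply: inj_row_free => w; rewrite -[w]hsubmxK tr_row_mx mul_row_col => w0.
have scal (s : 'M[R]_1) : s = (s 0 0)%:M by rewrite -mx11_scalar.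
have : lsubmx w 0 0 *: u + rsubmx w 0 0 *: v = 0.
  apply: trmx_inj; rewrite trmx0 -[RHS]w0 linearD !linearZ /=.
  by rewrite {2}(scal (lsubmx w)) {2}(scal (rsubmx w)) !mul_scalar_mx.
move/free => [a0 b0].
by rewrite (scal (lsubmx w)) (scal (rsubmx w)) a0 b0 !raddf0 row_mx0.
Qed.

(** Two independent directions leave a single normal line. *)
Lemma conormal_unique (M : 'M[R]_(3, 2)) (c n : 'rV[R]_3) :
  \rank M = 2%N -> c *m M = 0 -> n *m M = 0 -> n != 0 -> exists t, c = t *: n.
Proof.
move=> rM cM nM n0.
have nK : (n <= kermx M)%MS by rewrite sub_kermx nM.
have cK : (c <= kermx M)%MS by rewrite sub_kermx cM.
apply/sub_rVP/(submx_trans cK).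
by rewrite -(geq_leqif (mxrank_leqif_sup nK)) mxrank_ker rM rank_rV n0.
Qed.

End Vectors.

(** * The faces of the pentagonal icositetrahedron *)

Section Icositetrahedron.
Variables (R : realType) (alpha : R).
Hypothesis halpha : alpha ^+ 3 - alpha ^+ 2 - alpha - 1 = 0.

Let alpha3 : alpha ^+ 3 = alpha ^+ 2 + alpha + 1.
Proof. by move: halpha; lra. Qed.

Let alpha4 : alpha ^+ 4 = 2 * alpha ^+ 2 + 2 * alpha + 1.
Proof. by rewrite exprS alpha3 !mulrDr -exprS alpha3 mulr1 -expr2; ring. Qed.

(** Write [f] for the cubic.  For [r > 5/3] the factor [q] in
    [f alpha = (alpha - r) * q + f r] is positive, so [alpha - r] and [f r]
    have opposite signs; 57/31 and 46/25 are close to the root on either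
    side. *)
Lemma alpha_bounds : 57 < 31 * alpha /\ 25 * alpha < 46.
Proof.
have fac (r : R) : alpha ^+ 3 - alpha ^+ 2 - alpha - 1 =
  (alpha - r) * (alpha ^+ 2 + (r - 1) * alpha + (r ^+ 2 - r - 1))
    + (r ^+ 3 - r ^+ 2 - r - 1) by ring.
have pos (r : R) : 17 < 10 * r ->
    0 < alpha ^+ 2 + (r - 1) * alpha + (r ^+ 2 - r - 1).
  move=> r1.
  have -> : alpha ^+ 2 + (r - 1) * alpha + (r ^+ 2 - r - 1) =
     (alpha + (r - 1) / 2) ^+ 2 + (3 * r - 5) * (r + 1) / 4 by field.
  by apply: ltr_wpDl; rewrite ?sqr_ge0 //; nra.
split; rewrite ltNge; apply/negP => le.
  by have := fac (57/31); rewrite halpha; have := pos (57/31); nra.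
by have := fac (46/25); rewrite halpha; have := pos (46/25); nra.
Qed.

Let alpha_gt : 11 < 6 * alpha. Proof. by have [] := alpha_bounds; lra. Qed.
Let alpha_lt : 13 * alpha < 24. Proof. by have [] := alpha_bounds; lra. Qed.
Let alpha2_gt : 27 < 8 * alpha ^+ 2.
Proof. by have [] := alpha_bounds; nra. Qed.
Let alpha2_lt : 5 * alpha ^+ 2 < 17.
Proof. by have [] := alpha_bounds; nra. Qed.

Lemma alphaN2 : alpha ^- 2 = 2 * alpha - alpha ^+ 2.
Proof.
have a0 : alpha ^+ 2 != 0 by rewrite gt_eqF //; move: alpha2_gt; lra.
apply: (mulfI a0); rewrite mulfV //.
have -> : alpha ^+ 2 * (2 * alpha - alpha ^+ 2) = 2 * alpha ^+ 3 - alpha ^+ 4.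
  by ring.
by rewrite alpha3 alpha4; ring.
Qed.

Let beta := alpha ^+ 2 - 2.
(* This is alpha^-2, written as a polynomial so that all the quantities below
   are polynomials in alpha, reducible modulo the cubic. *)
Let gamma := 2 * alpha - alpha ^+ 2.
Let P := pentagonal_icositetrahedron alpha.

(** The last coordinate is [1/alpha]. *)
Definition normal0 : 'cV[R]_3 := point3 alpha 1 (alpha ^+ 2 - alpha - 1).

Definition vA := point3 alpha 0 0.
Definition vT : 'cV[R]_3 := point3 1 1 1.
Definition vG1 := point3 1 beta gamma.
Definition vG2 := point3 beta 1 (- gamma).
Definition vG3 := point3 beta gamma 1.

Lemma normal0_le s v : s \in rotation_codes ->
  v \in [:: vA; vT; vG1] -> dot normal0 (sp_mx R s *m v) <= alpha ^+ 2.
Proof.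
move=> Rs; rewrite !inE => vE.
suff : (dot normal0 (sp_mx R s *m vA) <= alpha ^+ 2) &&
    (dot normal0 (sp_mx R s *m vT) <= alpha ^+ 2) &&
    (dot normal0 (sp_mx R s *m vG1) <= alpha ^+ 2).
  by case/andP => /andP[? ?] ?; case/or3P: vE => /eqP ->.
rewrite !sp_mx_point3 //.
move: s Rs; apply/allP; rewrite rotation_codesE.
rewrite [all _ _]/= !dotE !mul1r !mulN1r.
(* Modulo the cubic, each of the 72 inequalities becomes linear in alpha and
   alpha^2, and the bounds on these two numbers decide it. *)
rewrite !(mulrN, mulr0, mulr1, oppr0, mul1r).
have -> : alpha * beta = alpha ^+ 2 - alpha + 1.
  by rewrite /beta; move: alpha3; lra.
have -> : alpha * gamma = alpha ^+ 2 - alpha - 1.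
  by rewrite /gamma; move: alpha3; lra.
have -> : (alpha ^+ 2 - alpha - 1) * alpha = 1 by move: alpha3; lra.
have -> : (alpha ^+ 2 - alpha - 1) * beta = 3 * alpha - 2 * alpha ^+ 2 + 2.
  by rewrite /beta; move: alpha3 alpha4; lra.
have -> : (alpha ^+ 2 - alpha - 1) * gamma = 2 - alpha.
  by rewrite /gamma; move: alpha3 alpha4; lra.
rewrite -expr2 /beta /gamma.
move: alpha_gt alpha_lt alpha2_gt alpha2_lt.
move: (alpha ^+ 2) => s; move: alpha => a a1 a2 s1 s2.
repeat (apply/andP; split); lra.
Qed.

Lemma vertex_mem M v : octahedral_rotations M -> v \in [:: vA; vT; vG1] ->
  P (M *m v).
Proof.
move=> OM; rewrite !inE => vE; apply: sub_gen_smallest.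
case/or3P: vE => /eqP ->; [left; left|left; right|right]; exists M => //.
by rewrite /vG1 /beta /gamma -alphaN2.
Qed.

Lemma P_stable M x : octahedral_rotations M -> P x -> P (M *m x).
Proof.
by move=> OM Px; rewrite /P -(octahedral_stable alpha OM); exists x.
Qed.

Lemma normal0_max x : P x -> dot normal0 x <= alpha ^+ 2.
Proof.
suff: (P `<=` [set y | dot normal0 y <= alpha ^+ 2])%classic by apply.
apply: smallest_sub => [u v t|_ [[]|] [M OM <-]].
- rewrite !inE /= => u_le v_le; rewrite /conv /= dotDr !dotZr.
  have t0 : 0 <= interval_inference.Itv.r t by exact: ge0.
  have t1 : interval_inference.Itv.r t <= 1 by exact: le1.
  rewrite /unstable.onem; move: (interval_inference.Itv.r t) t0 t1 => r r0 r1.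
  by nra.
all: have [g ->] := octahedral_rot_mx OM; rewrite /= /rot_mx.
- by apply: normal0_le; rewrite ?(valP g) ?inE ?eqxx.
- by apply: normal0_le; rewrite ?(valP g) ?inE ?eqxx ?orbT.
- by rewrite alphaN2; apply: normal0_le; rewrite ?(valP g) ?inE ?eqxx ?orbT.
Qed.

Definition face0 : set 'cV[R]_3 :=
  [set x | P x /\ dot normal0 x = alpha ^+ 2]%classic.

Lemma face0_vertices v : v \in [:: vA; vG2; vG1; vT; vG3] -> face0 v.
Proof.
have rot_mem s u : s \in rotation_codes -> u \in [:: vA; vT; vG1] ->
    P (sp_mx R s *m u).
  by move=> Rs; apply: vertex_mem; apply: (rot_mx_octahedral R (SeqSub Rs)).
have rot1 u : u \in [:: vA; vT; vG1] -> P u.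
  by rewrite -{2}[u]mul1mx; apply: vertex_mem; apply: octahedral1.
rewrite !inE => vE; split; last first.
  move: alpha3 alpha4 => a3 a4.
  by case/orP: vE => [|/or4P[]] /eqP ->; rewrite dotE /beta /gamma; lra.
case/orP: vE => [|/or4P[]] /eqP ->.
- by apply: rot1; rewrite inE eqxx.
- have := rot_mem [:: (false, 1%N); (false, 0%N); (true, 2%N)] vG1.
  rewrite sp_mx_point3 //= !mul1r mulN1r; apply=> //.
  by rewrite !inE eqxx ?orbT.
- by apply: rot1; rewrite !inE eqxx ?orbT.
- by apply: rot1; rewrite !inE eqxx ?orbT.
- have := rot_mem [:: (false, 1%N); (false, 2%N); (false, 0%N)] vG1.
  rewrite sp_mx_point3 //= !mul1r; apply=> //.
  by rewrite !inE eqxx ?orbT.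
Qed.

(** If [n = normal0] and [n'] is the normal of the face on the other side of
    the edge [u v], the planes [vol u v p = 0] and [(n - n') . p = 0] are the
    same, as both contain [u] and [v]; so [vol u v p >= 0] when no rotation
    makes the product of [p] with [n] larger.  The pentagon is then cut into
    three triangles by the diagonals from [vA]. *)
Lemma face0_cone q :
  {in rotation_codes,
    forall s, dot normal0 (sp_mx R s *m q) <= dot normal0 q} ->
  exists u v w a b c, [/\ face0 u, face0 v & face0 w] /\
    [/\ 0 <= a, 0 <= b, 0 <= c & q = a *: u + b *: v + c *: w].
Proof.
have [x [y [z ->]]] := point3P q => qmax.
have cone u v w : u \in [:: vA; vG2; vG1; vT; vG3] ->
    v \in [:: vA; vG2; vG1; vT; vG3] -> w \in [:: vA; vG2; vG1; vT; vG3] ->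
    0 < vol u v w -> 0 <= vol v w (point3 x y z) ->
    0 <= vol w u (point3 x y z) -> 0 <= vol u v (point3 x y z) ->
    exists u v w a b c, [/\ face0 u, face0 v & face0 w] /\
    [/\ 0 <= a, 0 <= b, 0 <= c & point3 x y z = a *: u + b *: v + c *: w].
  move=> Vu Vv Vw d pu pv pw; have [a [b [c abc]]] := cone3 d pu pv pw.
  by exists u, v, w, a, b, c; split=> //; split; apply: face0_vertices.
have edge (s : signed_perm) u v k : s \in rotation_codes -> 0 <= k ->
    vol u v (point3 x y z) = k * (dot normal0 (point3 x y z)
      - dot normal0 (sp_mx R s *m point3 x y z)) ->
    0 <= vol u v (point3 x y z).
  by move=> Rs k0 ->; rewrite mulr_ge0 // subr_ge0; apply: qmax.
(* The proportionality factors of the edges that avoid vA, resp. contain it. *)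
have k1 : 0 <= alpha - 1 by move: alpha_gt; lra.
have k2 : 0 <= (alpha ^+ 2 - 1) / 2 by move: alpha2_gt; lra.
have a3 t : alpha ^+ 3 * t = alpha ^+ 2 * t + alpha * t + t.
  by rewrite alpha3; ring.
have a4 t : alpha ^+ 4 * t = 2 * alpha ^+ 2 * t + 2 * alpha * t + t.
  by rewrite alpha4; ring.
have {a3 a4} a34 := (a3 x, a3 y, a3 z, a4 x, a4 y, a4 z).
have e1 : 0 <= vol vA vG2 (point3 x y z).
  apply: (edge [:: (false, 0%N); (true, 2%N); (false, 1%N)]) k2 _ => //.
  rewrite sp_mx_point3 //= !mul1r !mulN1r !dotE volE /beta /gamma.
  by case: a34 => -[[[[]]]]; lra.
have e2 : 0 <= vol vG2 vG1 (point3 x y z).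
  apply: (edge [:: (false, 1%N); (false, 0%N); (true, 2%N)]) k1 _ => //.
  rewrite sp_mx_point3 //= !mul1r !mulN1r !dotE volE /beta /gamma.
  by case: a34 => -[[[[]]]]; lra.
have e3 : 0 <= vol vG1 vT (point3 x y z).
  apply: (edge [:: (false, 1%N); (false, 2%N); (false, 0%N)]) k1 _ => //.
  rewrite sp_mx_point3 //= !mul1r !dotE volE /beta /gamma.
  by case: a34 => -[[[[]]]]; lra.
have e4 : 0 <= vol vT vG3 (point3 x y z).
  apply: (edge [:: (false, 2%N); (false, 0%N); (false, 1%N)]) k1 _ => //.
  rewrite sp_mx_point3 //= !mul1r !dotE volE /beta /gamma.
  by case: a34 => -[[[[]]]]; lra.
have e5 : 0 <= vol vG3 vA (point3 x y z).
  apply: (edge [:: (false, 0%N); (false, 2%N); (true, 1%N)]) k2 _ => //.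
  rewrite sp_mx_point3 //= !mul1r !mulN1r !dotE volE /beta /gamma.
  by case: a34 => -[[[[]]]]; lra.
have alpha5 : alpha ^+ 5 = 4 * alpha ^+ 2 + 3 * alpha + 2.
  rewrite exprS alpha4 !mulrDr mulr1 mulrCA -exprS alpha3 mulrCA -expr2.
  by ring.
have d1 : 0 < vol vA vG2 vG1.
  rewrite volE /beta /gamma.
  by move: alpha3 alpha4 alpha5 alpha_gt alpha_lt alpha2_gt alpha2_lt; lra.
have d2 : 0 < vol vA vG1 vT.
  rewrite volE /beta /gamma.
  by move: alpha3 alpha4 alpha5 alpha_gt alpha_lt alpha2_gt alpha2_lt; lra.
have d3 : 0 < vol vA vT vG3.
  rewrite volE /beta /gamma.
  by move: alpha3 alpha4 alpha5 alpha_gt alpha_lt alpha2_gt alpha2_lt; lra.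
have [f1|f1] := lerP (vol vA vG1 (point3 x y z)) 0.
  by apply: (cone vA vG2 vG1); rewrite ?inE ?eqxx ?orbT // vol_swap oppr_ge0.
have [f2|f2] := lerP (vol vA vT (point3 x y z)) 0.
  by apply: (cone vA vG1 vT);
    rewrite ?inE ?eqxx ?orbT ?(ltW f1) // vol_swap oppr_ge0.
by apply: (cone vA vT vG3); rewrite ?inE ?eqxx ?orbT ?(ltW f2).
Qed.

Lemma face0_is_face : is_face P face0.
Proof.
split.
  exists normal0^T, (alpha ^+ 2); split=> //; last first.
    by move=> x; apply: normal0_max.
  apply/eqP => n0; have : dot normal0 vT = 0 by rewrite /dot n0 mul0mx mxE.
  by rewrite dotE; move: alpha_gt; nra.
exists vA, vT, vG1; split; [| | |apply: rank_free_pair => a b];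
  try by apply: face0_vertices; rewrite !inE eqxx ?orbT.
rewrite -!scaleN1r !point3Z !point3D !point3Z point3D.
have -> : 0 = point3 0 0 0 :> 'cV[R]_3.
  by apply/colP => -[[|[|[|//]]] ?]; rewrite !mxE.
move/point3_inj => [_]; rewrite /beta /gamma => e2 e3.
have : b * (2 * alpha ^+ 2 - 2 * alpha - 2) = 0 by lra.
move/eqP; rewrite mulf_eq0 => /orP[/eqP b0|/eqP]; last first.
  by move: alpha_lt alpha2_gt; lra.
by move: e2; rewrite b0; split=> //; lra.
Qed.

(** Each of the 23 rotations other than the identity moves one of [vA], [vT]
    and [vG1] out of the plane of the face. *)
Lemma face0_free s : s \in rotation_codes ->
  (forall x, face0 x -> face0 (sp_mx R s *m x)) -> s = sp_one.
Proof.
move=> Rs fixed.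
have fixed_vertex v : v \in [:: vA; vG2; vG1; vT; vG3] ->
    dot normal0 (sp_mx R s *m v) = alpha ^+ 2.
  by move=> /face0_vertices/fixed[].
have := fixed_vertex vA; have := fixed_vertex vT; have := fixed_vertex vG1.
rewrite !inE !eqxx ?orbT => /(_ isT) + /(_ isT) + /(_ isT).
rewrite !sp_mx_point3 //.
have := alpha3; have := alpha4; have := alpha_gt; have := alpha_lt.
have := alpha2_gt; have := alpha2_lt => ? ? ? ? ? ?.
move: Rs; rewrite rotation_codesE !inE.
repeat case/orP; move=> /eqP ->;
  rewrite /= ?dotE ?mul1r ?mulN1r /beta /gamma /=; try by [].
all: by move=> *; exfalso; lra.
Qed.

(** The number [r] is the gauge of the polyhedron at [q], and it is attained on
    the face with normal [normal0] rotated by the inverse of [h]. *)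
Lemma gauge q : exists (h : rotation) (r : R),
  [/\ 0 <= r, dot normal0 (rot_mx R h *m q) = r * alpha ^+ 2 &
   forall (c : 'rV[R]_3) b, (forall x, P x -> (c *m x) 0 0 <= b) ->
     (c *m q) 0 0 <= r * b].
Proof.
pose height (g : rotation) : R := dot normal0 (rot_mx R g *m q).
have [h _ hmax] := @arg_maxP _ _ _ 1%g xpredT height isT.
have [|u [v [w [r [s [t [[[Pu nu] [Pv nv] [Pw nw]] [r0 s0 t0 hqE]]]]]]]] :=
    @face0_cone (rot_mx R h *m q).
  move=> s Rs; rewrite mulmxA -[sp_mx R s]/(rot_mx R (SeqSub Rs)) -rot_mxM.
  exact: hmax.
exists h, (r + s + t); split; first by rewrite !addr_ge0.
  by rewrite hqE !dotDr !dotZr nu nv nw; ring.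
move=> c b c_le.
have back x : P x -> (c *m (rot_mx R h^-1%g *m x)) 0 0 <= b.
  by move=> Px; apply: c_le; apply: P_stable Px; apply: rot_mx_octahedral.
rewrite -[q]mul1mx -(rot_mxV R h) -mulmxA hqE !mulmxDr -!scalemxAr.
rewrite !mx11D !mx11Z.
by rewrite !mulrDl !lerD // ler_wpM2l // back.
Qed.

Lemma face_rotated F : is_face P F ->
  exists g : rotation, F = mximage (rot_mx R g) face0.
Proof.
case=> -[c [b [c0 c_le F_def]]] [x [y [z [Fx Fy Fz rk]]]].
(* The origin is interior: apply the gauge inequality at the vector c. *)
have b_gt0 : 0 < b.
  have cc_gt0 : 0 < (c *m c^T) 0 0.
    have [i ci] := rV0Pn _ c0; rewrite mxE (bigD1 i) //= mxE ltr_pwDl //.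
      by rewrite -expr2 lt0r sqr_ge0 sqrf_eq0 ci.
    by apply: sumr_ge0 => j _; rewrite mxE -expr2 sqr_ge0.
  have [h [r [r0 _ /(_ c b c_le)/(lt_le_trans cc_gt0)]]] := gauge c^T.
  rewrite ltNge => /negP rb; rewrite ltNge; apply/negP.
  by move=> /(mulr_ge0_le0 r0).
have cF q : F q -> (c *m q) 0 0 = b by rewrite F_def => -[].
have PF q : F q -> P q by rewrite F_def => -[].
have [h [r [_ hp /(_ c b c_le)]]] := gauge (x + y + z).
rewrite !mulmxDr !mx11D !cF // => r_ge3.
have {}r_ge3 : 3 <= r by rewrite -(ler_pM2r b_gt0); lra.
pose n := normal0^T *m rot_mx R h.
have nE q : (n *m q) 0 0 = dot normal0 (rot_mx R h *m q).
  by rewrite /n -mulmxA.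
have n_le q : F q -> (n *m q) 0 0 <= alpha ^+ 2.
  move=> /PF Pq; rewrite nE; apply: normal0_max; apply: P_stable Pq.
  exact: rot_mx_octahedral.
have [nx ny nz] : [/\ (n *m x) 0 0 = alpha ^+ 2, (n *m y) 0 0 = alpha ^+ 2 &
    (n *m z) 0 0 = alpha ^+ 2].
  move: hp (n_le _ Fx) (n_le _ Fy) (n_le _ Fz); rewrite -nE !mulmxDr !mx11D.
  move: ((n *m x) 0 0) ((n *m y) 0 0) ((n *m z) 0 0) => dx dy dz.
  have := ler_wpM2r (sqr_ge0 alpha) r_ge3.
  by move=> *; split; lra.
have flat (d : 'rV[R]_3) a : (d *m x) 0 0 = a -> (d *m y) 0 0 = a ->
    (d *m z) 0 0 = a -> d *m row_mx (y - x) (z - x) = 0.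
  move=> dx dy dz; rewrite mul_mx_row !mulmxBr.
  rewrite (mx11_scalar (d *m x)) (mx11_scalar (d *m y)).
  by rewrite (mx11_scalar (d *m z)) dx dy dz !subrr row_mx0.
have [k cE] : exists k, c = k *: n.
  apply: (conormal_unique rk); first by apply: (flat _ b); apply: cF.
    exact: flat nx ny nz.
  apply/eqP => n0; move: nx; rewrite n0 mul0mx mxE.
  by move: alpha2_gt; lra.
have k0 : k != 0 by apply: contraNneq c0 => k0; rewrite cE k0 scale0r.
have cnE q : (c *m q) 0 0 = k * (n *m q) 0 0 by rewrite cE -scalemxAl mxE.
have bE : b = k * alpha ^+ 2 by rewrite -nx -cnE cF.
exists h^-1%g; rewrite F_def; apply/seteqP; split=> [q [Pq cq]|_ [q [Pq nq] <-]].
  exists (rot_mx R h *m q); last by rewrite mulmxA rot_mxV mul1mx.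
  split; first by apply: P_stable Pq; apply: rot_mx_octahedral.
  by rewrite -nE; apply: (mulfI k0); rewrite -bE -cnE.
split; first by apply: P_stable Pq; apply: rot_mx_octahedral.
by rewrite cnE nE bE mulmxA -rot_mxM mulgV rot_mx1 mul1mx nq.
Qed.

End Icositetrahedron.

(** * Simple transitivity and the count *)

Section Torsor.
Variables (R : realType) (alpha : R).
Hypothesis halpha : alpha ^+ 3 - alpha ^+ 2 - alpha - 1 = 0.

Definition rot_elt (g : rotation) : elt (octahedral_group alpha) :=
  exist _ (rot_mx R g) (rot_mx_octahedral R g).

Lemma rot_eltM g h : rot_elt (g * h)%g = eltM (rot_elt g) (rot_elt h).
Proof. by apply: elt_inj; apply: rot_mxM. Qed.

Lemma rot_elt_surj a : exists g, rot_elt g = a.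
Proof.
have [g gE] := octahedral_rot_mx (svalP a).
by exists g; apply: elt_inj; rewrite gE.
Qed.

Definition base_face : face (pentagonal_icositetrahedron alpha) :=
  exist _ _ (face0_is_face halpha).

Lemma rotation_regular : bijective (fun g => face_act (rot_elt g) base_face).
Proof.
have surj F : exists g, face_act (rot_elt g) base_face = F.
  have [g gE] := face_rotated halpha (svalP F).
  by exists g; apply: face_inj.
pose idx F := sval (cid (surj F)).
have idxK F : face_act (rot_elt (idx F)) base_face = F.
  by rewrite /idx; case: cid.
exists idx => // g; set h := idx _.
have : face_act (rot_elt (g^-1 * h)%g) base_face = base_face.
  rewrite rot_eltM face_actM idxK -face_actM -rot_eltM mulVg.
  by rewrite (elt_of1 rot_eltM rot_elt_surj) face_act1.
move/(congr1 sval) => /= fixed.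
have gh1 : (g^-1 * h)%g = 1%g.
  apply: val_inj; apply: (face0_free halpha (valP _)) => x x0.
  by rewrite -[face0 _]fixed; exists x.
by rewrite -[LHS](mulKVg g) gh1 mulg1.
Qed.

End Torsor.

Theorem theorem11 (R : realType) (alpha : R)
    (halpha : alpha ^+ 3 - alpha ^+ 2 - alpha - 1 = 0)
    (D : tile_designs (octahedral_group alpha)) :
  let t : rat := #|tile D|%:R in
  [/\ finite_set (tiling_orbits D),
      (#|` fset_set (tiling_orbits D)|)%fset%:R
        = 1 / 24 * (t ^+ 24 + 6 * t ^+ 6 + 3 * t ^+ 12 + 8 * t ^+ 8
                    + 6 * t ^+ 12) :> rat
    & 1 / 24 * (t ^+ 24 + 6 * t ^+ 6 + 3 * t ^+ 12 + 8 * t ^+ 8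
                + 6 * t ^+ 12)
        = 1 / 24 * (t ^+ 24 + 9 * t ^+ 12 + 8 * t ^+ 8 + 6 * t ^+ 6) :> rat].
Proof.
move=> t.
have [fin card24] := tiling_orbits_card D (@rot_eltM R alpha)
  (@rot_elt_surj R alpha) (rotation_regular halpha).
split=> //; last by ring.
rewrite card_rotation in card24.
have {}card24 : (#|` fset_set (tiling_orbits D)|%fset * 24 =
    #|tile D| ^ 24 + 9 * #|tile D| ^ 12 + 8 * #|tile D| ^ 8
    + 6 * #|tile D| ^ 6)%N.
  rewrite card24; exact: (sum_rotation_order (fun n => #|tile D| ^ (24 %/ n))%N).
have {}card24 : (#|` fset_set (tiling_orbits D)|)%fset%:R * 24 =
    t ^+ 24 + 9 * t ^+ 12 + 8 * t ^+ 8 + 6 * t ^+ 6 :> rat.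
  by rewrite -(natrM _ _ 24) card24 /t -!natrX -!natrM -!natrD.
have -> : t ^+ 24 + 6 * t ^+ 6 + 3 * t ^+ 12 + 8 * t ^+ 8 + 6 * t ^+ 12 =
    (#|` fset_set (tiling_orbits D)|)%fset%:R * 24 by rewrite card24; ring.
by field.
Qed.
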